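(* Let $\beta\in(1,2)$ be a Sturmian number, i.e. $d_\beta(1)$ is aperiodic and $1-1/\beta\leq T_\beta^n1\leq 1$ for all $n\geq 0$. Then $d_\beta(1)$ is the Sturmian word $1c_\alpha$ for some irrational $\alpha\in(0,1)$.
   Context: For $\beta>1$, $T_\beta(x)=\beta x\bmod 1$ on $[0,1]$, and $d_\beta(x)=(x_i)_{i\ge1}$ with $x_i=\lfloor \beta T_\beta^{i-1}(x)\rfloor$ is the $\beta$-expansion; for $\beta\in(1,2)$ it lies in $\{0,1\}^{\mathbb N}$. Aperiodic means not ultimately periodic (equivalently here, $\{T_\beta^n1\}_{n\ge0}$ is infinite). A Sturmian word is an infinite binary word with exactly $n+1$ factors of length $n$ for each $n$. For irrational $\alpha\in(0,1)$, the characteristic word $c_\alpha$ is defined by $c_\alpha(n)=\lfloor\alpha(n+2)\rfloor-\lfloor\alpha(n+1)\rfloor$, $n\ge0$. *)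

(* Defs.v *)
From HB Require Import structures.
From mathcomp Require Export all_boot all_order all_algebra.
From mathcomp Require Export boolp classical_sets functions cardinality reals.

Set Implicit Arguments.
Unset Strict Implicit.
Unset Printing Implicit Defensive.

Import Order.TTheory GRing.Theory Num.Theory.
Local Open Scope classical_set_scope.
Local Open Scope ring_scope.

Definition Tbeta (R : realType) (beta x : R) : R :=
  beta * x - (Num.floor (beta * x))%:~R.

(* Words are indexed from 0: letter i is the digit floor (beta * T^i x), which
   mathematical writing usually indexes by i + 1. *)
Definition dbeta (R : realType) (beta x : R) : nat -> int :=
  fun i => Num.floor (beta * iter i (Tbeta beta) x).

Definition ultimately_periodic (w : nat -> int) : Prop :=
  exists N p : nat, (0 < p)%N /\ forall n, (N <= n)%N -> w (n + p)%N = w n.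

Definition aperiodic (w : nat -> int) : Prop := ~ ultimately_periodic w.

Definition sturmian_number (R : realType) (beta : R) : Prop :=
  [/\ 1 < beta < 2,
      aperiodic (dbeta beta 1) &
      forall n : nat, 1 - 1 / beta <= iter n (Tbeta beta) 1 <= 1].

Definition factors (w : nat -> int) (n : nat) : set (seq int) :=
  [set mkseq (fun j => w (i + j)%N) n | i in [set: nat]].

Definition sturmian_word (w : nat -> int) : Prop :=
  (forall i, w i = 0 \/ w i = 1) /\
  (forall n : nat, (factors w n #= `I_n.+1)%card).

Definition characteristic_word (R : realType) (alpha : R) : nat -> int :=
  fun n => Num.floor (alpha * (n + 2)%:R) - Num.floor (alpha * (n + 1)%:R).

Definition word_cons (a : int) (w : nat -> int) : nat -> int :=
  fun n => if n is m.+1 then w m else a.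

(* Main.v *)
Require Import Defs.
From mathcomp Require Import zify ring lra.
Set Implicit Arguments.
Unset Strict Implicit.
Unset Printing Implicit Defensive.
Import Order.TTheory GRing.Theory Num.Theory.
Local Open Scope ring_scope.

(** Write [x_n] for the orbit of [1], [w_n] for its digits and [s_n] for the
number of ones among the first [n] digits.  The hypothesis [1 - 1/beta <= x_n]
says that [T] sends orbit points of digit 0 above [beta - 1], while points of
digit 1 always go below it.  So [(x, k) |-> (T x, k + digit x)] preserves the
lexicographic order modulo [(1, k) ~ (1 - 1/beta, k + 1)]: it is the lift of a
monotone circle map.  Hence if [x_m <= x_m'], the numbers of ones in the blocks
of length [j] starting at [m] and [m'] are equal, or the second is larger by
one.  Comparing with [x_0 = 1] gives
[s_(m+n) <= s_m + s_n <= s_(m+n) + 1], so [s] has a slope [alpha] with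
[alpha n <= s_n <= alpha n + 1].  Aperiodicity makes [alpha] irrational and the
inequalities strict, whence [s_n = floor (alpha n) + 1].

For the complexity, the factor of length [n] at position [m] is encoded by the
set of [j] in [1, n] such that [s_(m+j) < s_m + s_j].  These sets form a chain,
and aperiodicity separates any two indices [j], so every cardinality from [0]
to [n] occurs exactly once. *)

(** * Counting functions and eventual periodicity *)

Definition prefix_count (w : nat -> bool) (n : nat) : nat :=
  (\sum_(i < n) w i)%N.

Definition nearly_additive (s : nat -> nat) : Prop :=
  forall m n, (s (m + n) <= s m + s n <= (s (m + n)).+1)%N.

(** The eventual increment over [p] steps is [b - a]; two constants avoid truncated subtraction. *)
Definition ultimately_affine (s : nat -> nat) : Prop :=
  exists N p a b : nat,
    (0 < p)%N /\ forall n, (N <= n)%N -> (s (n + p) + a = s n + b)%N.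

Lemma prefix_count0 w : prefix_count w 0 = 0%N.
Proof. by rewrite /prefix_count big_ord0. Qed.

Lemma prefix_countS w n : prefix_count w n.+1 = (prefix_count w n + w n)%N.
Proof. by rewrite /prefix_count big_ord_recr. Qed.

Lemma ultimately_affine_periodic (w : nat -> bool) :
  ultimately_affine (prefix_count w) ->
  ultimately_periodic (fun n => (w n : nat)%:Z).
Proof.
move=> [N [p [a [b [p0 H]]]]]; exists N, p; split=> // n Nn; congr Posz.
have := H n Nn; have := H n.+1 (leqW Nn).
by rewrite addSn !prefix_countS; lia.
Qed.

Lemma nonincreasing_nat_stationary (V : nat -> nat) :
  (forall n, (V n.+1 <= V n)%N) ->
  exists N, forall n, (N <= n)%N -> V n.+1 = V n.
Proof.
move=> VS.
have exV : exists k, `[< exists n, V n = k >] by exists (V 0); apply/asboolP; exists 0.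
case: (ex_minnP exV) => _ /asboolP[N <-] minV.
have le_N n : (N <= n)%N -> (V n <= V N)%N.
  elim: n => [|n IH]; first by rewrite leqn0 => /eqP ->.
  rewrite leq_eqVlt => /predU1P[<- //|Nn]; apply: leq_trans (VS n) (IH Nn).
have eq_N n : (N <= n)%N -> V n = V N.
  by move=> Nn; apply/eqP; rewrite eqn_leq le_N // minV //; apply/asboolP; exists n.
by exists N => n Nn; rewrite !eq_N // leqW.
Qed.

(** * Slope *)

Lemma nearly_additive_mul (s : nat -> nat) (m n : nat) :
  s 0 = 0%N -> nearly_additive s ->
  (s (m * n) <= m * s n <= s (m * n) + m)%N.
Proof.
move=> s0 sD; elim: m => [|m IH]; first by rewrite !mul0n s0.
by have := sD n (m * n)%N; rewrite !mulSn; lia.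
Qed.

(** Splitting [m * n] into [m] blocks of length [n], or [n] of length [m], bounds [s (m * n)] in two
    ways, so each [(s n - 1) / n] is at most each [s m / m]. The supremum of the former separates
    the two families. *)
Lemma nearly_additive_slope (R : realType) (s : nat -> nat) :
  s 0 = 0%N -> nearly_additive s ->
  exists alpha : R, forall n,
    alpha * n%:R <= (s n)%:R <= alpha * n%:R + 1.
Proof.
move=> s0 sD.
pose E : set R := [set ((s n)%:R - 1) / n%:R | n in [set n | (0 < n)%N]]%classic.
have cmp n m : (0 < n)%N -> (0 < m)%N ->
    ((s n)%:R - 1) / n%:R <= (s m)%:R / m%:R :> R.
  move=> n0 m0; rewrite ler_pdivrMr ?ltr0n // mulrAC ler_pdivlMr ?ltr0n //.
  rewrite mulrBl mul1r lerBlDr -!natrM -natrD ler_nat.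
  have := nearly_additive_mul n m s0 sD; have := nearly_additive_mul m n s0 sD.
  by rewrite [(m * n)%N]mulnC [(s n * m)%N]mulnC [(s m * n)%N]mulnC; lia.
have ubE m : (0 < m)%N -> ubound E ((s m)%:R / m%:R).
  by move=> m0 _ [n n0 <-]; apply: cmp.
have E0 : (E !=set0)%classic by exists (((s 1)%:R - 1) / 1%:R); exists 1%N.
exists (sup E) => -[|n]; first by rewrite s0 !mulr0 add0r lexx ler01.
apply/andP; split.
  by rewrite -ler_pdivlMr ?ltr0n //; apply: ge_sup => //; apply: ubE.
rewrite -lerBlDr -ler_pdivrMr ?ltr0n //.
apply: (@ub_le_sup _ E); last by exists n.+1.
by exists ((s 1)%:R / 1%:R); apply: ubE.
Qed.

(* The potential is the sum of [s] over a window of length [q], minus [n * p]: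
   it is monotone because [s (n + q) - s n - p] has a constant sign. *)
Lemma rational_slope_ultimately_affine (s : nat -> nat) (p q : nat) :
  (0 < q)%N -> nearly_additive s ->
  (forall n, p * n <= q * s n <= p * n + q)%N -> ultimately_affine s.
Proof.
move=> q0 sD sl.
pose W n := (\sum_(i < q) s (n + i))%N.
have WS n : (W n.+1 + s n = W n + s (n + q))%N.
  rewrite /W; case: q q0 {sl W} => // q _.
  rewrite big_ord_recr [in RHS]big_ord_recl /= addn0 addSnnS.
  under [in RHS]eq_bigr do rewrite /bump /= add1n -addSnnS.
  by lia.
have Wge n : (n * p <= W n)%N.
  rewrite -(leq_pmul2l q0) /W big_distrr /=.
  rewrite -[X in (X * (n * p))%N](card_ord q) -sum_nat_const.
  by apply: leq_sum => i _; have := sl (n + i)%N; lia.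
(* For [i < q], [p * (n + i) + q] is at most [n * p + q * (p + 1)]. *)
have Wle n : (W n <= n * p + q * (p + 1))%N.
  rewrite -(leq_pmul2l q0) /W big_distrr /=.
  rewrite -[X in (X * (_ + _))%N](card_ord q) -sum_nat_const.
  apply: leq_sum => i _; have := sl (n + i)%N; have := ltn_ord i; nia.
(* By near additivity [s (n + q) - s n] is [s q] or [s q - 1]. So [W n - n * p] never increases if
   [s q = p] and never decreases if [s q = p.+1]. *)
have [sq|sq] : s q = p \/ s q = p.+1 by have := sl q; nia.
- have [n|N HN] := @nonincreasing_nat_stationary (fun n => W n - n * p)%N.
    by have := WS n; have := sD n q; have := Wge n; have := Wge n.+1; lia.
  exists N, q, 0%N, p; split => // n /HN.
  by have := WS n; have := sD n q; have := Wge n; have := Wge n.+1; lia.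
- have [n|N HN] :=
    @nonincreasing_nat_stationary (fun n => n * p + q * (p + 1) - W n)%N.
    by have := WS n; have := sD n q; have := Wle n; have := Wle n.+1; lia.
  exists N, q, 0%N, p; split => // n /HN.
  by have := WS n; have := sD n q; have := Wle n; have := Wle n.+1; lia.
Qed.

Lemma slope_irrational (R : realType) (s : nat -> nat) (alpha : R) :
  nearly_additive s -> ~ ultimately_affine s ->
  0 <= alpha ->
  (forall n, alpha * n%:R <= (s n)%:R <= alpha * n%:R + 1) ->
  irrational alpha.
Proof.
move=> sD nper alpha0 sl [r _ ra]; apply: nper.
have r0 : 0 <= r by rewrite -(@ler0q R) ra.
have dr0 : (0 < `|denq r|)%N by rewrite absz_gt0 denq_neq0.
have da : alpha * (`|denq r|%N)%:R = (`|numq r|%N)%:R.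
  rewrite -ra /ratr !pmulrn !gez0_abs ?denq_ge0 ?numq_ge0 //.
  by rewrite divfK // intr_eq0 denq_neq0.
apply: (rational_slope_ultimately_affine dr0 sD (p := `|numq r|%N)) => n.
rewrite -!(ler_nat R) natrD !natrM -da.
have -> : alpha * (`|denq r|%N)%:R * n%:R = (`|denq r|%N)%:R * (alpha * n%:R).
  by ring.
rewrite -[X in _ <= _ + X]mulr1 -mulrDr.
by rewrite !ler_pM2l ?ltr0n.
Qed.

Lemma slope_floor (R : realType) (s : nat -> nat) (alpha : R) (n : nat) :
  irrational alpha -> (0 < n)%N ->
  alpha * n%:R <= (s n)%:R <= alpha * n%:R + 1 ->
  (s n)%:Z = Num.floor (alpha * n%:R) + 1.
Proof.
move=> irr n0 /andP[lo hi].
(* Irrationality only has to make the lower bound strict: then [s n - 1 <= alpha * n < s n]. *)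
have ne (k : int) : alpha * n%:R != k%:~R.
  apply/eqP => E; apply: irr; exists (k%:~R / n%:R) => //.
  rewrite fmorph_div /= ratr_int ratr_nat -E mulfK //.
  by rewrite pnatr_eq0 -lt0n.
have -> : Num.floor (alpha * n%:R) = (s n)%:Z - 1; last by rewrite subrK.
apply: floor_def; rewrite subrK intrB -[X in _ - X]/1 lerBlDr hi /=.
by rewrite lt_neqAle ne.
Qed.

(** * Complexity *)

(** If the next cardinality after [t] skipped [t.+1], two points of [A y] would lie outside [A x].
    Any [A z] is contained in [A x] or contains [A y], so none could separate them. *)
Lemma chain_card_onto (T : finType) (I : Type) (A : I -> {set T}) :
  (forall x y, A x \subset A y \/ A y \subset A x) ->
  (exists x, A x = finset.set0) ->
  (forall i, exists x, i \in A x) ->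
  (forall i j, i != j -> exists x, (i \in A x) != (j \in A x)) ->
  forall t, (t <= #|T|)%N -> exists x, #|A x| = t.
Proof.
move=> chain [x0 Ax0] cov sep.
have sub x y : (#|A x| <= #|A y|)%N -> A x \subset A y.
  move=> le; have [//|yx] := chain x y.
  by have /eqP -> : A y == A x by rewrite eqEcard yx.
elim=> [_|t IH tT]; first by exists x0; rewrite Ax0 cards0.
have [x cx] := IH (ltnW tT).
have ex : exists k, `[< (t < k)%N /\ exists y, #|A y| = k >].
  have /existsP[i ix] : [exists i, i \notin A x].
    apply: contraLR tT; rewrite negb_exists -leqNgt -cx => /forallP allx.
    by apply/subset_leq_card/fintype.subsetP => i _; apply/negPn/allx.
  have [y iy] := cov i; exists #|A y|; apply/asboolP; split; last by exists y.
  rewrite -cx ltnNge; apply: contra ix => /sub /fintype.subsetP; exact.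
case: (ex_minnP ex) => k /asboolP[+ [y yk]]; rewrite -{k}yk => ty miny.
have [/eqP ? | ny] := boolP (#|A y| == t.+1); first by exists y.
have : (1 < #|A y :\: A x|)%N.
  by rewrite cardsDS ?sub ?cx; lia.
case/card_gt1P => i [j []]; rewrite !inE => /andP[ix iy] /andP[jx jy] /sep[z].
have [zt|tz] := leqP #|A z| t.
  have /fintype.subsetP zx := sub z x (leq_trans zt (eq_leq (esym cx))).
  by rewrite (contraNF (zx i) ix) (contraNF (zx j) jx).
have /fintype.subsetP yz : A y \subset A z.
  by apply: sub; apply: miny; apply/asboolP; split=> //; exists z.
by rewrite !yz.
Qed.

Lemma card_range_eq (I : choiceType) (T U : Type) (f : I -> T) (g : I -> U) (i0 : I) :
  (forall x y, f x = f y <-> g x = g y) -> (range f #= range g)%card.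
Proof.
move=> fg; pose h v := g (xget i0 [set x | f x = v]%classic).
have hf x : h (f x) = g x.
  by apply/fg; apply: (@xgetI _ i0 [set y | f y = f x]%classic x).
have -> : range g = (h @` range f)%classic.
  by rewrite image_comp; apply: eq_imagel => x _ /=; rewrite hf.
rewrite card_eq_sym; apply: inj_card_eq => _ _ /set_mem[x _ <-] /set_mem[y _ <-].
by rewrite !hf => /fg.
Qed.

(** The ordinal [j] stands for the block length [j.+1], since length 0 never has a defect. *)
Definition defect_set (s : nat -> nat) (n m : nat) : {set 'I_n} :=
  finset (fun j : 'I_n => (s (m + j.+1) < s m + s j.+1)%N).

Lemma card_factors (w : nat -> bool) (n : nat) :
  let s := prefix_count w in
  nearly_additive s -> ~ ultimately_affine s ->
  (forall m m', (forall j, s (m + j) + s m' <= s (m' + j) + s m)%N \/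
                (forall j, s (m' + j) + s m <= s (m + j) + s m')%N) ->
  (factors (fun i => (w i : nat)%:Z) n #= `I_n.+1)%card.
Proof.
move=> s sD naff chain; pose A := defect_set s n.
have inA m (j : 'I_n) : (j \in A m) = (s (m + j.+1) < s m + s j.+1)%N.
  by rewrite inE.
have chainA x y : A x \subset A y \/ A y \subset A x.
  case: (chain x y) => H; [right|left]; apply/fintype.subsetP => j;
    by rewrite !inA; have := H j.+1; lia.
have onto t : (t <= n)%N -> exists m, #|A m| = t.
  rewrite -{1}(card_ord n); apply: chain_card_onto => //.
  - exists 0%N; apply/setP => j; rewrite inA inE /s prefix_count0 !add0n.
    by rewrite ltnn.
  (* If [j] lay in no set, [s (m + j.+1) = s m + s j.+1] would hold for all [m]. *)
  - move=> j; apply: contrapT => H; apply: naff.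
    exists 0%N, j.+1, 0%N, (s j.+1); split=> // m _.
    have /negP : ~ (j \in A m) by move=> jm; apply: H; exists m.
    by rewrite inA; have := sD m j.+1; lia.
  - move=> i j; wlog ij : i j / (i < j)%N.
      move=> W ne; case: (ltngtP i j) => [ij|ji|/val_inj/eqP].
      - exact: W.
      - have [|x xne] := W j i ji; first by rewrite eq_sym.
        by exists x; rewrite eq_sym.
      - by rewrite (negPf ne).
    move=> _; apply: contrapT => H; apply: naff.
    (* Equal defects at [i] and [j] for every [m] give, with [k = m + i.+1], a constant increment of
       [s] from [k] to [k + (j - i)]. *)
    exists i.+1, (j - i)%N, (s i.+1), (s j.+1); split; first by rewrite subn_gt0.
    move=> k ik; have Em : (i.+1 + (k - i.+1) = k)%N by rewrite subnKC.
    set m := (k - i.+1)%N in Em.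
    have : (i \in A m) = (j \in A m) by apply/eqP/negPn/negP => ne; apply: H; exists m.
    rewrite !inA; have := sD m i.+1; have := sD m j.+1.
    have -> : (m + i.+1 = k)%N by lia.
    have -> : (m + j.+1 = k + (j - i))%N by lia.
    by lia.
have -> : `I_n.+1 = range (fun m => #|A m|).
  apply/seteqP; split=> [t|_ [m _ <-]] /=; first by rewrite ltnS => /onto[m <-]; exists m.
  by rewrite ltnS -[X in (_ <= X)%N](card_ord n) max_card.
apply: (card_range_eq 0%N) => m m'; split=> [E|E].
  have eqw j : (j < n)%N -> w (m + j)%N = w (m' + j)%N.
    move=> jn; have := congr1 (fun v => nth 0 v j) E.
    by rewrite /= !nth_mkseq // => -[]; case: (w _); case: (w _).
  have eqs j : (j <= n)%N -> (s (m + j) + s m' = s (m' + j) + s m)%N.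
    elim: j => [|j IH] jn; first by rewrite !addn0 addnC.
    by have := IH (ltnW jn); rewrite !addnS /s !prefix_countS eqw //; lia.
  congr #|pred_of_set _|; apply/setP => j; rewrite !inA.
  by have := eqs j.+1 (ltn_ord j); lia.
have EA : A m = A m'.
  apply/eqP; case: (chainA m m') => [H|H]; last rewrite eq_sym.
    by rewrite eqEcard H E /=.
  by rewrite eqEcard H E /=.
have eqs j : (j <= n)%N -> (s (m + j) + s m' = s (m' + j) + s m)%N.
  case: j => [|j] jn; first by rewrite !addn0 addnC.
  have := congr1 (fun B : {set 'I_n} => Ordinal jn \in B) EA.
  by rewrite /= !inA /=; have := sD m j.+1; have := sD m' j.+1; lia.
apply/eq_in_map => j; rewrite mem_iota add0n => /= jn; congr Posz.
have := eqs j (ltnW jn); have := eqs j.+1 jn.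
by rewrite !addnS /s !prefix_countS; lia.
Qed.

(** * The orbit of 1 *)

Lemma sturmian_digit (R : realType) (beta : R) (n : nat) :
  sturmian_number beta ->
  dbeta beta 1 n = ((1 <= beta * iter n (Tbeta beta) 1)%R : nat)%:Z.
Proof.
move=> [/andP[b1 b2] _ /(_ n) /andP[lo hi]]; rewrite /dbeta.
set x := iter n _ _ in lo hi *.
have x0 : 0 <= x by apply: le_trans lo; rewrite subr_ge0 ler_pdivrMr; lra.
have bx : 0 <= beta * x by apply: mulr_ge0; lra.
have bx2 : beta * x < 2 by apply: le_lt_trans b2; rewrite ler_piMr; lra.
by apply: floor_def; rewrite intrD -!pmulrn; case: (leP 1 (beta * x)) => h /=; lra.
Qed.

Lemma sturmian_orbitS (R : realType) (beta : R) (n : nat) :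
  sturmian_number beta ->
  iter n.+1 (Tbeta beta) 1 =
  beta * iter n (Tbeta beta) 1 - ((1 <= beta * iter n (Tbeta beta) 1)%R : nat)%:R.
Proof.
by move=> h; rewrite iterS {1}/Tbeta -/(dbeta beta 1 n) sturmian_digit // pmulrn.
Qed.

Lemma sturmian_orbit_compare (R : realType) (beta : R) :
  sturmian_number beta ->
  let x n := iter n (Tbeta beta) 1 in
  let s := prefix_count (fun n => 1 <= beta * x n) in
  forall m m', x m <= x m' ->
  forall j, (s (m + j) + s m' <= s (m' + j) + s m <= (s (m + j) + s m').+1)%N.
Proof.
move=> h x s m m' xm j.
have [/andP[b1 b2] _ rng] := h.
have b0 : 0 < beta by lra.
have lo n : beta - 1 <= beta * x n.
  have /andP[+ _] := rng n; rewrite -(ler_pM2l b0) mulrBr mulr1 mul1r divff //.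
  exact: lt0r_neq0.
have hi n : beta * x n <= beta.
  by have /andP[_ +] := rng n; rewrite -/(x n) -[X in _ -> _ <= X]mulr1 ler_pM2l.
(* Invariant: equal counts with the order kept, or the second count one ahead with the order
   reversed. The state changes exactly when the digits differ, as [beta - 1] then separates the two
   images. *)
suff : (s (m + j) + s m' = s (m' + j) + s m)%N /\ x (m + j)%N <= x (m' + j)%N \/
       ((s (m + j) + s m').+1 = s (m' + j) + s m)%N /\ x (m' + j)%N <= x (m + j)%N.
  by case=> -[]; lia.
elim: j => [|j IH]; first by left; rewrite !addn0 addnC.
have xS n : x n.+1 = beta * x n - ((1 <= beta * x n)%R : nat)%:R.
  exact: sturmian_orbitS.
rewrite !addnS !xS /s !prefix_countS -/s.
have := lo (m + j)%N; have := lo (m' + j)%N.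
have := hi (m + j)%N; have := hi (m' + j)%N.
case: IH => -[sE /(ler_wpM2l (ltW b0))];
  case: (leP 1 (beta * x (m + j)%N)); case: (leP 1 (beta * x (m' + j)%N)) => /= *;
  solve [left; split; [lia|lra] | right; split; [lia|lra] | exfalso; lra].
Qed.

Theorem theorem9 (R : realType) (beta : R) (hbeta : sturmian_number beta) :
  sturmian_word (dbeta beta 1) /\
  exists alpha : R,
    [/\ irrational alpha,
        0 < alpha < 1 &
        forall n : nat,
          dbeta beta 1 n = word_cons 1 (characteristic_word alpha) n].
Proof.
pose x n := iter n (Tbeta beta) 1.
pose w n := 1 <= beta * x n; pose s := prefix_count w.
have dE : dbeta beta 1 = fun n => (w n : nat)%:Z.
  by apply: funext => n; apply: sturmian_digit.
have [/andP[b1 b2] aper rng] := hbeta.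
have s0 : s 0%N = 0%N := prefix_count0 w.
have cmp m m' : x m <= x m' -> forall j,
    (s (m + j) + s m' <= s (m' + j) + s m <= (s (m + j) + s m').+1)%N.
  exact: sturmian_orbit_compare.
have naff : ~ ultimately_affine s.
  by move=> /ultimately_affine_periodic; rewrite -dE.
have sD : nearly_additive s.
  move=> m n; have x1 : x m <= x 0%N by have /andP[] := rng m.
  have := cmp m 0%N x1 n; rewrite add0n s0; lia.
have chain m m' : (forall j, s (m + j) + s m' <= s (m' + j) + s m)%N \/
                  (forall j, s (m' + j) + s m <= s (m + j) + s m')%N.
  by case/orP: (le_total (x m) (x m')) => H; [left|right] => j;
    case/andP: (cmp _ _ H j).
have w0 : w 0%N = true by rewrite /w /x /= mulr1 ltW.
have s1 : s 1%N = 1%N by rewrite /s prefix_countS prefix_count0 w0.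
split.
  rewrite dE; split=> [i|n]; first by case: (w i); [right|left].
  exact: card_factors.
have [alpha sl] := @nearly_additive_slope R s s0 sD.
have := sl 1%N; rewrite s1 mulr1 => /andP[a1 a0].
have alpha0 : 0 <= alpha by lra.
have irr := slope_irrational sD naff alpha0 sl.
have fl n : (0 < n)%N -> (s n)%:Z = Num.floor (alpha * n%:R) + 1.
  by move=> n0; apply: slope_floor.
exists alpha; split=> //.
  have ne (n : nat) : alpha != n%:R.
    by apply/eqP => E; apply: irr; exists n%:R => //; rewrite ratr_nat.
  by rewrite !lt_neqAle alpha0 a1 eq_sym (ne 0%N) (ne 1%N).
(* The first letter is treated apart because the floor formula fails at [s 0 = 0]; later letters are
   differences of consecutive counts, where the [+ 1] cancels. *)
case=> [|n]; rewrite dE /= ?w0 // /characteristic_word addn2 addn1.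
have := fl n.+1 isT; have := fl n.+2 isT.
by rewrite {1}/s prefix_countS -/s; lia.
Qed.
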